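(* For every $h>0$ let $\phi^h:=u_h^g$ with $g(w)=|w|$. Then, for every $\eta>0$ there exist $c_0=c_0(r,\eta)>0$ and $h_0=h_0(r,\eta)>0$ such that for every $h\le h_0$ $$\phi^h(w)\le(|w|+c_0h)\vee\eta\qquad\text{for every }w\in\mathbb{R}^N.$$ Moreover, for every $\alpha\in(0,1/(N+1))$ there exists $h_1=h_1(\alpha)>0$ such that $\phi^h(0)\le2h^\alpha$ for every $h\le h_1$.
   Context: Fix $N\in\mathbb N$ and $r>0$; $a\vee b=\max\{a,b\}$. $\mathscr L^{+}$ is the set of Lipschitz functions $g:\mathbb{R}^N\to\mathbb{R}$ with $\lim_{|x|\to\infty}g(x)=+\infty$. $B_r(w)$ is the open ball of centre $w$ and radius $r$, $B_r=B_r(0)$, $C_r=\overline{B_r}\times\overline{B_r}$, $\operatorname{osc}_A v=\operatorname{ess\,sup}_A v-\operatorname{ess\,inf}_A v$. $\mathcal M^+(C_r)$ is the set of nonnegative Radon measures on $C_r$. $L^\infty_{\mathbf w}(\mathbb{R}^N;\mathcal M^+(C_r))$ is the set of maps $w\mapsto z_w\in\mathcal M^+(C_r)$ such that $w\mapsto\int_{C_r}f\,dz_w$ is measurable for every $f\in C^0(C_r)$ and $w\mapsto z_w(C_r)$ is in $L^\infty(\mathbb{R}^N)$. The nonlocal divergence $\mathfrak{Div}^r z$ is the Radon measure on $\mathbb{R}^N$ with $\int\varphi\,d(\mathfrak{Div}^r z)=-\frac1{2r}\int_{\mathbb{R}^N}\int_{C_r}(\varphi(w+x)-\varphi(w+y))\,dz_w(x,y)\,dw$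 for $\varphi\in C^0_c(\mathbb{R}^N)$. For $g\in\mathscr L^+$ and $h>0$, $u_h^g$ denotes the unique Lipschitz function in $\mathscr L^+$ for which there is $z\in L^\infty_{\mathbf w}(\mathbb{R}^N;\mathcal M^+(C_r))$ with $z_w(C_r)\le1$ and $\int_{C_r}(u_h^g(w+x)-u_h^g(w+y))\,dz_w(x,y)=\operatorname{osc}_{B_r(w)}u_h^g$ for a.e. $w$, and $-h\,\mathfrak{Div}^r z+u_h^g=g$ as measures on $\mathbb{R}^N$ (existence and uniqueness are known). *)

(* Defs.v *)
From HB Require Import structures.
From mathcomp Require Import all_boot all_order all_algebra.
From mathcomp Require Import all_classical all_reals all_analysis.
From mathcomp Require Import ess_sup_inf.

Set Implicit Arguments.
Unset Strict Implicit.
Unset Printing Implicit Defensive.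

Import Order.TTheory GRing.Theory Num.Theory.
Import numFieldNormedType.Exports.

Local Open Scope classical_set_scope.
Local Open Scope ring_scope.

(* The points of R^N are the row vectors 'rV[R]_N.  The norm that the library
   puts on them is the sup norm: it is used for its topology only, and |x| is
   the Euclidean norm enorm. *)

Section euclidean.
Context {R : realType} {N : nat}.
Implicit Types (x w : 'rV[R]_N) (g : 'rV[R]_N -> R).

Definition enorm x : R := Num.sqrt (\sum_(i < N) x ord0 i ^+ 2).

Definition eball w (r : R) : set 'rV[R]_N := [set x | enorm (x - w) < r].

Definition elipschitz g : Prop :=
  exists L : R, forall x y, `|g x - g y| <= L * enorm (x - y).

Definition coercive g : Prop :=
  forall M : R, exists K : R, forall x, K < enorm x -> M < g x.

Definition Lplus g : Prop := elipschitz g /\ coercive g.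

End euclidean.

(* N-dimensional Lebesgue measure: the restriction to the Caratheodory
   measurable sets (that is, to the Lebesgue measurable sets) of the outer
   measure obtained from countable covers by half-open boxes.  A cover is a
   sequence of optional boxes: None is an absent box, so that the empty set has
   measure 0 also when N = 0, where every box is a point of volume 1. *)
Section lebesgue.
Context {R : realType} {N : nat}.
Local Notation V := 'rV[R]_N.

Definition box (ab : V * V) : set V :=
  [set x | forall i : 'I_N, ab.1 ord0 i <= x ord0 i < ab.2 ord0 i].

(* The cut-off at 0 gives empty boxes volume 0. *)
Definition boxvol (ab : V * V) : R :=
  \prod_(i < N) Num.max 0 (ab.2 ord0 i - ab.1 ord0 i).

Definition obox (o : option (V * V)) : set V := oapp box set0 o.

Definition oboxvol (o : option (V * V)) : \bar R := (oapp boxvol 0 o)%:E.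

Definition box_cover (A : set V) : set (nat -> option (V * V)) :=
  [set c | A `<=` \bigcup_k obox (c k)].

Definition lebesgueN_outer (A : set V) : \bar R :=
  ereal_inf [set (\sum_(k <oo) oboxvol (c k))%E | c in box_cover A].

Local Open Scope ereal_scope.

Lemma oboxvol_ge0 o : 0 <= oboxvol o.
Proof.
by case: o => [ab|] //=; rewrite lee_fin; apply: prodr_ge0 => i _;
  rewrite le_max lexx.
Qed.

Lemma lebesgueN_outer_ge0 A : 0 <= lebesgueN_outer A.
Proof.
by apply: le_ereal_inf_tmp => _ [c _ <-]; apply: nneseries_ge0 => k _ _;
  exact: oboxvol_ge0.
Qed.

Lemma lebesgueN_outer0 : lebesgueN_outer set0 = 0.
Proof.
apply/eqP; rewrite eq_le lebesgueN_outer_ge0 andbT.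
by apply: ereal_inf_lbound; exists (fun=> None) => //; exact: eseries0.
Qed.

Lemma le_lebesgueN_outer : {homo lebesgueN_outer : A B / A `<=` B >-> A <= B}.
Proof.
move=> A B AB; apply: ereal_inf_le_tmp => _ [c Bc <-]; exists c => //.
exact: subset_trans AB Bc.
Qed.

Lemma lebesgueN_outer_sigma_subadditive : sigma_subadditive lebesgueN_outer.
Proof.
move=> A; have [[i ioo]|] := pselect (exists i, lebesgueN_outer (A i) = +oo).
  rewrite (eseries_pinfty _ _ ioo) ?leey// => n _.
  by rewrite -ltNye (lt_le_trans _ (lebesgueN_outer_ge0 _)).
rewrite -forallNE => Aoo.
suff add2e (e : {posnum R}) : lebesgueN_outer (\bigcup_n A n) <=
    \sum_(i <oo) lebesgueN_outer (A i) + e%:num%:E.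
  by apply/lee_addgt0Pr => _/posnumP[].
rewrite (le_trans _ (epsilon_trick _ _ _))//; last first.
  by move=> n; exact: lebesgueN_outer_ge0.
pose P n (c : nat -> option (V * V)) := box_cover (A n) c /\
  \sum_(k <oo) oboxvol (c k) <=
    lebesgueN_outer (A n) + (e%:num / (2 ^ n.+1)%:R)%:E.
have [G PG] : {G : nat -> nat -> option (V * V) & forall n, P n (G n)}.
  apply: (@choice _ _ P) => n.
  have en1 : (0 < e%:num / (2 ^ n.+1)%:R :> R)%R by [].
  have : lebesgueN_outer (A n) \is a fin_num.
    by rewrite ge0_fin_numE ?lebesgueN_outer_ge0// ltey; apply/eqP/Aoo.
  move=> /(lb_ereal_inf_adherent en1)[_ [c Ac <-] lec].
  by exists c; split => //; exact: ltW.
have G_ge0 x : 0 <= (oboxvol \o uncurry G) x by exact: oboxvol_ge0.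
apply: (@le_trans _ _ (\esum_(i in setT) (oboxvol \o uncurry G) i)).
  apply: ereal_inf_lbound => /=.
  have /card_esym/ppcard_eqP[f] := card_nat2.
  exists (uncurry G \o f).
    move=> t [i _ /(PG i).1[j _ Gijt]].
    by exists (f^-1%FUN (i, j)) => //=; rewrite invK ?inE.
  rewrite -(esum_pred_image (oboxvol \o uncurry G) _ xpredT) ?[fun=> _]set_true//.
  by rewrite image_eq.
rewrite (_ : esum _ _ = \sum_(i <oo) \sum_(j <oo) oboxvol (G i j)); last first.
  pose J : nat -> set (nat * nat) := fun i => [set (i, j) | j in setT].
  rewrite (_ : setT = \bigcup_k J k); last first.
    by rewrite predeqE => -[a b]; split => // _; exists a => //; exists b.
  rewrite esum_bigcupT /=; last 2 first.
    - apply/trivIsetP => i j _ _ ij.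
      rewrite predeqE => -[n m] /=; split => //= -[] [_] _ [<-{n} _].
      by move=> [m' _] [] /esym/eqP; rewrite (negbTE ij).
    - by move=> /= [n m]; exact: oboxvol_ge0.
  rewrite -(image_id [set: nat]) -fun_true esum_pred_image//; last first.
    by move=> n _; apply: esum_ge0 => *; exact: oboxvol_ge0.
  apply: eq_eseriesr => /= j _.
  rewrite -(esum_pred_image (oboxvol \o uncurry G) (pair j) predT)//=; last 2 first.
    by move=> n _; exact: oboxvol_ge0.
    by move=> ? ? _ _; exact: (@can_inj _ _ _ snd).
  by congr esum; rewrite predeqE => -[a b]; split; move=> [i _ <-]; exists i.
apply: lee_lim.
- apply: is_cvg_nneseries => n *.
  by apply: nneseries_ge0 => m *; exact: (G_ge0 (n, m)).
- by apply: is_cvg_nneseries => n *; apply: adde_ge0 => //;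
    exact: lebesgueN_outer_ge0.
- by near=> n; apply: lee_sum => i _; exact: (PG i).2.
Unshelve. all: by end_near. Qed.

HB.instance Definition _ := isOuterMeasure.Build R V lebesgueN_outer
  lebesgueN_outer0 lebesgueN_outer_ge0 le_lebesgueN_outer
  lebesgueN_outer_sigma_subadditive.

Definition lebesgueN : set (caratheodory_type lebesgueN_outer) -> \bar R :=
  lebesgueN_outer.

Let lebesgueN0 : lebesgueN set0 = 0.
Proof. exact: lebesgueN_outer0. Qed.

Let lebesgueN_ge0 A : 0 <= lebesgueN A.
Proof. exact: lebesgueN_outer_ge0. Qed.

Let lebesgueN_semi_sigma_additive : semi_sigma_additive lebesgueN.
Proof.
by move=> F mF tF mUF; exact: caratheodory_measure_sigma_additive.
Qed.

HB.instance Definition _ := isMeasure.Build _ _ _ lebesgueN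
  lebesgueN0 lebesgueN_ge0 lebesgueN_semi_sigma_additive.

End lebesgue.

Arguments lebesgueN {R N}.

Section resolvent.
Context {R : realType} {N : nat}.
Local Notation V := 'rV[R]_N.
Local Notation borelVV := (g_sigma_algebraType (@open (V * V)%type)).

Definition ess_sup_on (A : set V) (v : V -> R) : \bar R :=
  ereal_inf [set y | {ae lebesgueN, forall x, A x -> ((v x)%:E <= y)%E}].

Definition ess_inf_on (A : set V) (v : V -> R) : \bar R :=
  ereal_sup [set y | {ae lebesgueN, forall x, A x -> (y <= (v x)%:E)%E}].

Definition osc (A : set V) (v : V -> R) : \bar R :=
  (ess_sup_on A v - ess_inf_on A v)%E.

Definition Cr (r : R) : set (V * V) :=
  closure (eball 0 r) `*` closure (eball 0 r).

(* A nonnegative Radon measure on the compact set C_r is a finite Borel measure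
   on R^N x R^N that does not charge the complement of C_r. *)
Definition measure_field : Type :=
  V -> {finite_measure set borelVV -> \bar R}.

(* Measurability of the total mass w |-> z_w(C_r) is the case f = 1 of the
   second clause. *)
Definition Linfty_w (r : R) (z : measure_field) : Prop :=
  [/\ forall w, z w (~` Cr r) = 0%E,
      forall f : V * V -> R, {within Cr r, continuous f} ->
        measurable_fun [set: caratheodory_type (@lebesgueN_outer R N)]
          (fun w => \int[z w]_(p in Cr r) f p) &
      (ess_sup lebesgueN (fun w => z w (Cr r)) < +oo)%E].

Definition Cc (phi : V -> R) : Prop :=
  continuous phi /\ compact (closure [set x | phi x != 0]).

(* The nonlocal divergence, as a functional on C^0_c(R^N): a (signed) Radon
   measure on R^N is determined by its integrals against C^0_c(R^N). *)
Definition nldiv (r : R) (z : measure_field) (phi : V -> R) : R :=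
  - (2 * r)^-1 * \int[lebesgueN]_w
      \int[z w]_(p in Cr r) (phi (w + p.1) - phi (w + p.2)).

(* u is u_h^g; the measure equation -h Div^r z + u = g is tested against
   C^0_c(R^N). *)
Definition is_resolvent (r h : R) (g u : V -> R) : Prop :=
  Lplus u /\
  exists z : measure_field,
    [/\ Linfty_w r z,
        {ae lebesgueN, forall w, (z w (Cr r) <= 1)%E},
        {ae lebesgueN, forall w,
          (\int[z w]_(p in Cr r) (u (w + p.1) - u (w + p.2))%:E)%E
            = osc (eball w r) u} &
        forall phi, Cc phi ->
          - h * nldiv r z phi + \int[lebesgueN]_w (u w * phi w)
            = \int[lebesgueN]_w (g w * phi w)].

End resolvent.

(* Main.v *)
Require Import Defs.
From HB Require Import structures.
From mathcomp Require Import all_boot all_order all_algebra.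
From mathcomp Require Import all_classical all_reals all_analysis.
From mathcomp Require Import measurable_realfun.
From mathcomp Require Import ring lra.

(* Write u for the resolvent of |.| and, for s > 0, m(x) = max(|x|, s).  Over
   the closed ball of radius r about w, every nondecreasing function v of m is
   minimal at the point q(w) closest to the origin, or at any point of the flat
   region of m; q can be chosen to have a Lipschitz inverse S, so that
   int f(q(w)) dw <= C int f for f >= 0, with C given by the Lipschitz constant
   of S.  Comparing u with v on each ball yields
   int (f(w+x) - f(w+y)) dz_w >= - f(q(w)) for f = (u - v)^+, with no need for a
   measure field adapted to v.  If v >= |x| + c, where c = h C / (2 r), testing
   the equation with f then gives int (u - |x| - c) f <= 0, hence f = 0 and
   u <= v.  The choice v = m + c + e m^2 makes f compactly supported; e -> 0
   leaves u <= max(|x|, s) + c for all s and h.  The first claim is the case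
   s = eta / 2, and since C = O(s^-N) the second one is the case s = h^alpha. *)

Import Order.TTheory GRing.Theory Num.Theory.
Import numFieldNormedType.Exports.

Local Open Scope classical_set_scope.
Local Open Scope ring_scope.

Set Implicit Arguments.
Unset Strict Implicit.
Unset Printing Implicit Defensive.

(** * Lebesgue measure of boxes *)

Section boxes.
Context {R : realType} {N : nat}.
Local Notation V := 'rV[R]_N.
Implicit Types (x a b : V).

Definition upd x (j : 'I_N) (t : R) : V :=
  \row_i (if i == j then t else x ord0 i).

(* [partvol 0] is the indicator of the box, [partvol N] its volume; integrating
   over the coordinate [j] turns [partvol j] into [partvol j.+1]. *)
Definition partvol (j : nat) (B : V * V) x : R :=
  \prod_(i < N) (if (i < j)%N then Num.max 0 (B.2 ord0 i - B.1 ord0 i)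
                 else (B.1 ord0 i <= x ord0 i < B.2 ord0 i)%R%:R).

Lemma partvol_ge0 j B x : 0 <= partvol j B x.
Proof.
by apply: prodr_ge0 => i _; case: ifP => _; rewrite ?ler0n// le_max lexx.
Qed.

Definition partvol_rest (j : 'I_N) (B : V * V) x : R :=
  \prod_(i < N | i != j) (if (i < j)%N then Num.max 0 (B.2 ord0 i - B.1 ord0 i)
                 else (B.1 ord0 i <= x ord0 i < B.2 ord0 i)%R%:R).

Lemma partvol_upd (j : 'I_N) B x t :
  partvol j B (upd x j t) =
  (B.1 ord0 j <= t < B.2 ord0 j)%R%:R * partvol_rest j B x.
Proof.
rewrite /partvol (bigD1 j)//= ltnn mxE eqxx; congr (_ * _).
by apply: eq_bigr => i ij; rewrite mxE (negbTE ij).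
Qed.

Lemma partvolS (j : 'I_N) B x :
  partvol j.+1 B x =
  Num.max 0 (B.2 ord0 j - B.1 ord0 j) * partvol_rest j B x.
Proof.
rewrite /partvol (bigD1 j)//= ltnSn; congr (_ * _).
by apply: eq_bigr => i ij; rewrite ltnS leq_eqVlt (inj_eq val_inj) (negbTE ij).
Qed.

Lemma partvol_rest_ge0 j B x : 0 <= partvol_rest j B x.
Proof.
by apply: prodr_ge0 => i _; case: ifP => _; rewrite ?ler0n// le_max lexx.
Qed.

Local Open Scope ereal_scope.

Lemma lebesgue_itvco (a b : R) :
  lebesgue_measure `[a, b[%classic = (Num.max 0 (b - a)%R)%:E.
Proof.
rewrite lebesgue_measure_itv/= lte_fin; case: ltP => ab.
  by rewrite max_r ?EFinB// subr_ge0 ltW.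
by rewrite max_l// subr_le0.
Qed.

(** The covering inequality is integrated in one coordinate after another, against one-dimensional
    Lebesgue measure. After [j] integrations the indicators of the covering boxes have become
    [partvol j]; after [N] only volumes are left. *)
Lemma boxvol_le_cover a b (c : nat -> option (V * V)) :
  (forall i, (a ord0 i <= b ord0 i)%R) ->
  box_cover (box (a, b)) c ->
  (boxvol (a, b))%:E <= \sum_(k <oo) oboxvol (c k).
Proof.
move=> ab cov.
pose F j k x : \bar R := (oapp (fun B => partvol j B x) 0%R (c k))%:E.
have F0 j k x : 0 <= F j k x.
  by rewrite lee_fin; case: (c k) => //= B; exact: partvol_ge0.
suff H j : (j <= N)%N -> forall x, box (a, b) x ->
    (\prod_(i < N | (i < j)%N) (b ord0 i - a ord0 i)%R)%:E <=
    \sum_(k <oo) F j k x.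
  (* A degenerate side makes the volume 0. Otherwise the corner [a] belongs to the half-open box,
     and the case [j = N] can be read at that point. *)
  have [e|ne] := pselect (exists i, a ord0 i = b ord0 i).
    case: e => i abi; rewrite /boxvol (bigD1 i)//= abi subrr maxxx mul0r.
    by apply: nneseries_ge0 => k _ _; exact: oboxvol_ge0.
  have abx : box (a, b) a.
    move=> i /=; rewrite lexx lt_neqAle ab andbT; apply/eqP => abi.
    by apply: ne; exists i.
  have := H N (leqnn N) a abx; congr (_ <= _).
    rewrite /boxvol; congr EFin; apply: eq_big => [i|i _]; first exact: ltn_ord.
    by rewrite max_r// subr_ge0 ab.
  apply: eq_eseriesr => k _; rewrite /F /oboxvol; congr EFin.
  case: (c k) => //= B; apply: eq_bigr => i _; by rewrite ltn_ord.
elim: j => [_ x /cov [k _ ckx]|j IH jN x abx].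
  rewrite big_pred0//.
  apply: (@le_trans _ _ (F 0%N k x)).
    rewrite lee_fin /F; move: ckx; case: (c k) => [B|]//= ckx.
    by rewrite /partvol big1// => i _; rewrite /= ckx.
  rewrite (@nneseriesD1 _ (fun k => F 0%N k x) k xpredT)//.
  by rewrite leeDl//; apply: nneseries_ge0.
pose jj : 'I_N := Ordinal jN.
pose P : R := (\prod_(i < N | (i < j)%N) (b ord0 i - a ord0 i))%R.
have -> : (\prod_(i < N | (i < j.+1)%N) (b ord0 i - a ord0 i) =
    P * (b ord0 jj - a ord0 jj))%R.
  rewrite (bigD1 jj)//= mulrC; congr (_ * _)%R; apply: eq_bigl => i.
  by rewrite ltnS [RHS]ltn_neqAle andbC.
pose D := `[a ord0 jj, b ord0 jj[%classic : set R.
have mD : measurable D by exact: measurable_itv.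
have P0 : (0 <= P)%R by apply: prodr_ge0 => i _; rewrite subr_ge0.
have -> : (P * (b ord0 jj - a ord0 jj))%:E =
    \int[lebesgue_measure]_(t in D) P%:E.
  rewrite integral_cst//= lebesgue_itvco EFinM; congr (_ * _).
  by rewrite max_r// subr_ge0.
pose G k (t : R) : \bar R := F j k (upd x jj t).
have GE k t : G k t = (oapp (fun B : V * V => (B.1 ord0 jj <= t < B.2 ord0 jj)%R%:R
     * partvol_rest jj B x) 0 (c k))%R%:E.
  by rewrite /G /F; congr EFin; case: (c k) => //= B; rewrite -partvol_upd.
have mind (B : V * V) : measurable_fun D
   (fun t => ((B.1 ord0 jj <= t < B.2 ord0 jj)%R%:R : R)).
  rewrite (_ : (fun t => _) = \1_(`[B.1 ord0 jj, B.2 ord0 jj[%classic : set R)).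
    by apply: measurable_indic; exact: measurable_itv.
  by apply/funext => t; rewrite indicE mem_setE in_itv.
have mG k : measurable_fun D (G k).
  rewrite (funext (GE k)).
  apply/measurable_EFinP; case: (c k) => [B|]/=; last exact: measurable_cst.
  by apply: measurable_funM => //; exact: measurable_cst.
(* Replacing the coordinate [jj] by any [t] in [D] stays in the box, so the induction hypothesis can
   be integrated over [D]; sum and integral are then exchanged. *)
apply: (@le_trans _ _ (\int[lebesgue_measure]_(t in D) \sum_(k <oo) G k t)).
  apply: ge0_le_integral => //=.
  - apply: (@ge0_emeasurable_sum _ _ _ _ _ xpredT) => [k t _ _|k _].
      exact: F0.
    exact: mG.
  - move=> t; rewrite /D/= in_itv/= => tab.
    apply: IH; first exact: ltnW.
    move=> i /=; rewrite mxE; case: eqP => [->//|_]; exact: abx.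
rewrite integral_nneseries//; last by move=> *; exact: F0.
apply: lee_nneseries => [k _ _|k _].
  by apply: integral_ge0 => *; exact: F0.
under eq_integral do rewrite GE.
rewrite /F; case: (c k) => [B|]/=; last by rewrite integral0.
rewrite -[j.+1]/(jj.+1) partvolS EFinM.
under eq_integral do rewrite EFinM.
rewrite ge0_integralZr//; last 2 first.
- by apply/measurable_EFinP; exact: mind.
- by rewrite lee_fin partvol_rest_ge0.
apply: lee_wpmul2r; first by rewrite lee_fin partvol_rest_ge0.
(* The integral sees only the part of the side of the covering box that lies in [D], which is no
   longer than the whole side. *)
rewrite -lebesgue_itvco.
pose E := `[B.1 ord0 jj, B.2 ord0 jj[%classic : set R.
have mE : measurable E by exact: measurable_itv.
rewrite (_ : (fun t => _) = EFin \o \1_E); last first.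
  by apply/funext => t /=; rewrite indicE mem_setE in_itv.
rewrite integral_indic//; apply: le_measure; rewrite ?inE//.
  exact: measurableI.
Qed.

End boxes.

(** * Borel sets *)

Lemma measurable_fun_preopen d (T : measurableType d) (R : realType)
    (f : T -> R) :
  (forall U, open U -> measurable (f @^-1` U)) -> measurable_fun setT f.
Proof.
move=> fU; apply: (measurability _ (RGenOpens.measurableE R)).
move=> _ [_ [a [b ->]] <-]; rewrite setTI; apply: fU; exact: interval_open.
Qed.

Section borel.
Context {R : realType} {N : nat}.
Local Notation V := 'rV[R]_N.
Local Notation mu := (@lebesgueN_outer R N).
Implicit Types (x a b : V).

Definition cutl (i : 'I_N) (t : R) (B : V * V) : V * V :=
  (B.1, upd B.2 i (Num.min (B.2 ord0 i) t)).

Definition cutr (i : 'I_N) (t : R) (B : V * V) : V * V :=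
  (upd B.1 i (Num.max (B.1 ord0 i) t), B.2).

(** The cut-off at 0 in [boxvol] makes this hold also when the hyperplane misses the box or the box
    is empty. *)
Lemma boxvol_cut i t B : boxvol (cutl i t B) + boxvol (cutr i t B) = boxvol B.
Proof.
rewrite /boxvol (bigD1 i)//= [X in _ + X](bigD1 i)//= [RHS](bigD1 i)//=.
rewrite !mxE eqxx.
have -> : \prod_(j < N | j != i) Num.max 0
    (upd B.2 i (Num.min (B.2 ord0 i) t) ord0 j - B.1 ord0 j) =
    \prod_(j < N | j != i) Num.max 0 (B.2 ord0 j - B.1 ord0 j).
  by apply: eq_bigr => j ji; rewrite mxE (negbTE ji).
have -> : \prod_(j < N | j != i) Num.max 0
    (B.2 ord0 j - upd B.1 i (Num.max (B.1 ord0 i) t) ord0 j) =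
    \prod_(j < N | j != i) Num.max 0 (B.2 ord0 j - B.1 ord0 j).
  by apply: eq_bigr => j ji; rewrite mxE (negbTE ji).
rewrite -mulrDl; congr (_ * _).
move: (B.1 _ _) (B.2 _ _) => p q.
rewrite /Num.max /Num.min.
by case: (ltP q t); case: (ltP p t) => ? ?; repeat case: ifPn; rewrite -?leNgt; lra.
Qed.

(** Cutting every box of a cover of [X] along the hyperplane gives covers of the two parts of [X],
    with the same total volume. *)
Lemma measurable_halfspace (i : 'I_N) (t : R) :
  mu.-caratheodory [set x : V | x ord0 i < t].
Proof.
apply: le_caratheodory_measurable => X.
apply: le_ereal_inf_tmp => _ [c Xc <-].
have volcut k : oboxvol (c k) = (oboxvol (omap (cutl i t) (c k)) +
    oboxvol (omap (cutr i t) (c k)))%E.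
  by case: (c k) => [B|]/=; rewrite /oboxvol/= -EFinD ?boxvol_cut ?addr0.
rewrite (eq_eseriesr (fun k _ => volcut k)) nneseriesD; last 2 first.
- by move=> k _ _; exact: oboxvol_ge0.
- by move=> k _ _; exact: oboxvol_ge0.
apply: leeD; apply: ereal_inf_lbound.
- exists (fun k => omap (cutl i t) (c k)) => // x [/Xc[k _ xk]/= xt].
  exists k => //; case: (c k) xk => //= B xB j /=.
  rewrite mxE; case: eqP => [->|_]; last exact: xB.
  by rewrite lt_min xt andbT; exact: xB.
- exists (fun k => omap (cutr i t) (c k)) => // x [/Xc[k _ xk]/= /negP xt].
  exists k => //; case: (c k) xk => //= B xB j /=.
  rewrite mxE; case: eqP => [->|_]; last exact: xB.
  by rewrite ge_max -andbA; have /andP[-> ->] := xB i; rewrite leNgt xt.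
Qed.

Lemma measurable_box (B : V * V) :
  measurable (box B : set (caratheodory_type mu)).
Proof.
rewrite (_ : box B = \bigcap_(i in [set: 'I_N])
   ([set x : V | x ord0 i < B.2 ord0 i] `&`
    ~` [set x : V | x ord0 i < B.1 ord0 i])).
  apply: fin_bigcap_measurable => // i _; apply: measurableI.
    exact: measurable_halfspace.
  by apply: measurableC; exact: measurable_halfspace.
apply/seteqP; split => [x xB i _|x xB i] /=.
  by have /andP[? ?] := xB i; split => //; apply/negP; rewrite -leNgt.
by have [/= -> /negP] := xB i I; rewrite -leNgt => ->.
Qed.

Lemma measurable_openN (U : set V) : open U ->
  measurable (U : set (caratheodory_type mu)).
Proof.
move=> oU.
pose B (ab : 'rV[rat]_N * 'rV[rat]_N) : V * V :=
  (map_mx ratr ab.1, map_mx ratr ab.2).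
(* [U] is the union of the boxes with rational corners that it contains. The other boxes are
   replaced by [set0], so that the union runs over a countable type. *)
rewrite (_ : U = \bigcup_ab (if `[< box (B ab) `<=` U >] then box (B ab)
    else set0)).
  apply: countable_bigcupT_measurable => // ab.
  case: ifP => _ //; exact: measurable_box.
apply/seteqP; split => [x Ux|x [ab _]]; last first.
  by case: ifPn => // /asboolP; exact.
have [e /= e0 eU] : exists2 e : R, 0 < e & ball x e `<=` U.
  by apply/nbhs_ballP; exact: open_nbhs_nbhs.
have ratl i : {q : rat | x ord0 i - e < ratr q < x ord0 i}.
  apply: cid; have [q] := @rat_in_itvoo R (x ord0 i - e) (x ord0 i)
    ltac:(by rewrite ltrBlDr ltrDl).
  by rewrite in_itv/= => ?; exists q.
have ratr' i : {q : rat | x ord0 i < ratr q < x ord0 i + e}.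
  apply: cid; have [q] := @rat_in_itvoo R (x ord0 i) (x ord0 i + e)
    ltac:(by rewrite ltrDl).
  by rewrite in_itv/= => ?; exists q.
exists (\row_i sval (ratl i), \row_i sval (ratr' i)) => //.
rewrite ifT; last first.
  apply/asboolP => y yB; apply: eU; split=> // i j; rewrite (ord1 i) /ball/=.
  have := yB j; rewrite /= !mxE.
  case: (ratl j) => /= q; case: (ratr' j) => /= s.
  by rewrite ltr_distlC; lra.
move=> j /=; rewrite !mxE.
by case: (ratl j) => /= q; case: (ratr' j) => /= s; lra.
Qed.

Lemma measurable_continuousN (f : V -> R) : continuous f ->
  measurable_fun [set: caratheodory_type mu] f.
Proof.
by move=> /continuousP cf; apply: measurable_fun_preopen => U /cf /measurable_openN.
Qed.

(** By [boxvol_le_cover] such a box has positive measure, so it does not fit into the exceptional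
    null set. *)
Lemma ae_box a b (P : V -> Prop) :
  (forall i, a ord0 i < b ord0 i) -> {ae lebesgueN, forall x, P x} ->
  exists2 x, box (a, b) x & P x.
Proof.
move=> ab [A [mA A0 nPA]]; apply: contrapT => noP.
have : (lebesgueN (box (a, b)) <= 0)%E.
  rewrite -A0; apply: le_outer_measure => x xab; apply: nPA => Px.
  by apply: noP; exists x.
apply/negP; rewrite -ltNge; apply: (@lt_le_trans _ _ (boxvol (a, b))%:E).
  by rewrite lte_fin; apply: prodr_gt0 => i _; rewrite lt_max subr_gt0 ab orbT.
apply: le_ereal_inf_tmp => _ [c cov <-]; apply: boxvol_le_cover => // i.
exact: ltW.
Qed.

End borel.

(** * Lipschitz images *)

Section lipschitz_image.
Context {R : realType} {N : nat}.
Local Notation V := 'rV[R]_N.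
Local Notation mu := (@lebesgueN_outer R N).
Implicit Types (x a b : V).

(** Lipschitz condition for the sup norm, written coordinatewise and with strict bounds to avoid
    maxima over the coordinates and to suit half-open boxes. *)
Definition sup_lipschitz (L : R) (S : V -> V) := forall (x y : V) (s : R),
  (forall i, `|x ord0 i - y ord0 i| < s) ->
  forall i, `|S x ord0 i - S y ord0 i| < L * s.

Lemma outer_le_boxvol (B : V * V) : (mu (box B) <= (boxvol B)%:E)%E.
Proof.
apply: ereal_inf_lbound; exists (fun n => if n == 0%N then Some B else None).
  by move=> x xB; exists 0%N.
rewrite (@nneseriesD1 _ _ 0%N)//=; last by move=> k _; exact: oboxvol_ge0.
by rewrite eseries0 ?adde0// => -[|k].
Qed.

Lemma outer_le_sum (I : finType) (F : I -> set V) (A : set V) :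
  (forall x, A x -> exists i, F i x) -> (mu A <= \sum_i mu (F i))%E.
Proof.
move=> AF; apply: (@le_trans _ _ (mu (\big[setU/set0]_i F i))).
  apply: le_outer_measure => x /AF[i Fix].
  by rewrite (bigD1 i)//=; left.
elim/big_ind2 : _ => [|B e C f Be Cf|i _]; first by rewrite outer_measure0.
  exact: le_trans (outer_measureU2 _ _ _) (leeD Be Cf).
by [].
Qed.

Lemma outer_image_cube L S (c : V) (s : R) : 0 <= s -> 0 <= L ->
  sup_lipschitz L S ->
  (mu (S @` box (c, (\row_i (c ord0 i + s))%R)) <= ((2 * L * s) ^+ N)%:E)%E.
Proof.
move=> s0 L0 lS.
pose B : V * V := (\row_i (S c ord0 i - L * s), \row_i (S c ord0 i + L * s)).
apply: (@le_trans _ _ (mu (box B))).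
  apply: le_outer_measure => _ [x xB <-] i; rewrite !mxE.
  have : `|S x ord0 i - S c ord0 i| < L * s.
    by apply: lS => j; have := xB j; rewrite /= mxE ltr_norml; lra.
  by rewrite ltr_norml; lra.
apply: le_trans (outer_le_boxvol _) _; rewrite lee_fin /boxvol.
rewrite (eq_bigr (fun=> 2 * L * s)); last first.
  move=> i _; rewrite /= !mxE max_r; first by ring.
  by rewrite opprB addrC subrKA addr_ge0 ?mulr_ge0.
by rewrite prodr_const card_ord.
Qed.

(** The box is cut into cubes of side [s], at most its shortest side. Rounding the number of cubes
    up at most doubles each side; with the factor 2 of [outer_image_cube] this gives [4 * L] per
    axis. *)
Lemma outer_image_box L S a b : 0 <= L -> sup_lipschitz L S ->
  (mu (S @` box (a, b)) <= ((4 * L) ^+ N * boxvol (a, b))%:E)%E.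
Proof.
move=> L0 lS.
have [ab|/existsNP[i /negP]] := pselect (forall i, a ord0 i < b ord0 i); last first.
  rewrite -leNgt => ba.
  rewrite (_ : _ @` _ = set0) ?outer_measure0; last first.
    apply/seteqP; split => // t [x xB _]; have /= := xB i; lra.
  rewrite lee_fin mulr_ge0 ?exprn_ge0 ?mulr_ge0//.
  by apply: prodr_ge0 => j _; rewrite le_max lexx.
have [s s0 sab] : exists2 s : R, 0 < s & forall i, s <= b ord0 i - a ord0 i.
  exists (\big[Order.min/1]_i (b ord0 i - a ord0 i)).
    by apply: lt_bigmin => [|i _]; rewrite ?ltr01// subr_gt0 ab.
  by move=> i; exact: bigmin_le.
pose n i := (Num.truncn ((b ord0 i - a ord0 i) / s)).+1.
have nP i : (b ord0 i - a ord0 i) / s < (n i)%:R <= 2 * ((b ord0 i - a ord0 i) / s).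
  have y1 : 1 <= (b ord0 i - a ord0 i) / s by rewrite ler_pdivlMr// mul1r.
  have := @truncn_itv R ((b ord0 i - a ord0 i) / s) (le_trans ler01 y1).
  rewrite /n => /andP[ty ->]/=.
  by rewrite -natr1; lra.
(* The number of cubes varies with the axis, whereas finite functions have a single codomain.
   Indices run over ['I_K], and those beyond [n i] get the empty set and the factor 0. *)
pose K := (\max_i n i)%N.
have nK i : (n i <= K)%N by exact: leq_bigmax.
pose F (i : 'I_N) (k : 'I_K) : R := if (k < n i)%N then 2 * L * s else 0.
pose C (f : {ffun 'I_N -> 'I_K}) : V := \row_i (a ord0 i + s * (f i)%:R).
pose B (f : {ffun 'I_N -> 'I_K}) : set V :=
  if [forall i, (f i < n i)%N] then box (C f, (\row_i (C f ord0 i + s))%R) else set0.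
apply: (@le_trans _ _ (\sum_f mu (S @` B f))%E).
  apply: outer_le_sum => _ [x xab <-].
  have xn i : (Num.truncn ((x ord0 i - a ord0 i) / s) < n i)%N.
    rewrite ltnS; apply: le_truncn; rewrite ler_pM2r ?invr_gt0//.
    by have /= := xab i; lra.
  exists [ffun i => Ordinal (leq_trans (xn i) (nK i))]; exists x => //.
  rewrite /B ifT; last by apply/forallP => i; rewrite ffunE/=.
  move=> i /=; rewrite !mxE ffunE /=.
  have := @truncn_itv R ((x ord0 i - a ord0 i) / s).
  rewrite divr_ge0 ?(ltW s0)//; last by have /= := xab i; lra.
  move=> /(_ isT); set t := Num.truncn _.
  rewrite ler_pdivlMr// ltr_pdivrMr// -natr1 mulrDl mul1r.
  by rewrite (mulrC s); lra.
apply: (@le_trans _ _ (\sum_(f : {ffun 'I_N -> 'I_K}) (\prod_i F i (f i))%:E)%E).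
  apply: lee_sum => f _; rewrite /B; case: ifPn => [/forallP fn|_]; last first.
    rewrite image_set0 outer_measure0 lee_fin; apply: prodr_ge0 => i _.
    by rewrite /F; case: ifP => // _; rewrite !mulr_ge0// ltW.
  apply: le_trans (outer_image_cube _ (ltW s0) L0 lS) _.
  rewrite lee_fin (eq_bigr (fun=> 2 * L * s)) ?prodr_const ?card_ord//.
  by move=> i _; rewrite /F fn.
(* Distributivity turns the sum over multi-indices into a product over the axes, which is then
   compared factor by factor. *)
rewrite sumEFin lee_fin -bigA_distr_bigA/=.
have -> : (4 * L) ^+ N * boxvol (a, b) =
    \prod_i (4 * L * (b ord0 i - a ord0 i)).
  rewrite big_split/= prodr_const card_ord; congr (_ * _).
  by apply: eq_bigr => i _; rewrite max_r// subr_ge0 ltW.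
apply: ler_prod => i _; apply/andP; split.
  by apply: sumr_ge0 => k _; rewrite /F; case: ifP => // _; rewrite !mulr_ge0// ltW.
rewrite /F -big_mkcond/= -(big_ord_widen K (fun=> 2 * L * s) (nK i)).
rewrite sumr_const card_ord -[leLHS]mulr_natr.
have /andP[_] := nP i; rewrite mulrA ler_pdivlMr// => nis.
rewrite (_ : 2 * L * s * _ = (2 * L) * ((n i)%:R * s)); last by ring.
rewrite (_ : 4 * L * _ = (2 * L) * (2 * (b ord0 i - a ord0 i))); last by ring.
by rewrite ler_wpM2l// mulr_ge0.
Qed.

Lemma outer_image_lipschitz L S (A : set V) : 0 < L -> sup_lipschitz L S ->
  (mu (S @` A) <= ((4 * L) ^+ N)%:E * mu A)%E.
Proof.
move=> L0 lS.
have C0 : 0 < (4 * L) ^+ N by rewrite exprn_gt0 ?mulr_gt0.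
(* Dividing by the constant leaves the infimum over covers alone on the right. *)
rewrite muleC -lee_pdivrMr//.
apply: le_ereal_inf_tmp => _ [c Ac <-].
rewrite lee_pdivrMr// muleC -nneseriesZl; last first.
  by move=> k _; exact: oboxvol_ge0.
apply: (@le_trans _ _ (\sum_(k <oo) mu (S @` obox (c k)))%E).
  apply: le_trans (outer_measure_sigma_subadditive mu _).
  by apply: le_outer_measure => _ [x /Ac[k _ xk] <-]; exists k => //; exists x.
apply: lee_nneseries => [k _ _|k _]; first exact: outer_measure_ge0.
case: (c k) => [[a b]|] /=.
  by rewrite /oboxvol/= -EFinM; apply: outer_image_box => //; exact: ltW.
by rewrite image_set0 outer_measure0 /oboxvol/= mule0.
Qed.

End lipschitz_image.

(** * Change of variables along a map with a Lipschitz left inverse *)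

Section pushforward.
Context {R : realType} {N : nat}.
Local Notation V := 'rV[R]_N.
Local Notation mu := (@lebesgueN R N).
Local Notation T := (caratheodory_type (@lebesgueN_outer R N)).
Local Notation B := (g_sigma_algebraType (@open V)).
Local Open Scope ereal_scope.

Lemma measurable_borelN (q : V -> V) : continuous q ->
  measurable_fun [set: T] (q : T -> B).
Proof.
move=> /continuousP cq; apply: (@measurability _ _ T B setT q (@open V)) => //.
by move=> _ [U oU <-]; rewrite setTI; apply: measurable_openN; exact: cq.
Qed.

(** As [S] inverts [q] on the left, the preimage of [A] under [q] lies in the image of [A] under
    [S]. Hence the pushforward of [mu] by [q] is at most [(4 * L) ^+ N] times [mu] on Borel sets. *)
Lemma integral_comp_expansion (L : R) (S q : V -> V) (f : V -> R) :
  (0 < L)%R -> sup_lipschitz L S -> cancel q S -> continuous q ->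
  continuous f -> (forall x, 0 <= f x)%R ->
  \int[mu]_w (f (q w))%:E <= ((4 * L) ^+ N)%:E * \int[mu]_w (f w)%:E.
Proof.
move=> L0 lS qS cq /continuousP cf f0.
have C0 : (0 <= (4 * L) ^+ N)%R by rewrite exprn_ge0 ?mulr_ge0 ?ltW.
have mq := measurable_borelN cq.
(* The identity from Lebesgue to Borel measurable sets lets both integrals be taken over Borel
   measures. *)
have mid : measurable_fun [set: T] (idfun : T -> B).
  by apply: measurable_borelN => x; exact: cvg_id.
have mf : measurable_fun [set: B] (EFin \o f).
  apply/measurable_EFinP; apply: measurable_fun_preopen => U /cf oU.
  exact: sub_sigma_algebra.
have pushE (p : T -> B) : measurable_fun setT p ->
    \int[mu]_w (f (p w))%:E = \int[pushforward mu p]_y (f y)%:E.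
  by move=> mp; rewrite ge0_integral_pushforward// => x _; rewrite lee_fin.
rewrite (pushE _ mq) (pushE _ mid).
rewrite -[((4 * L) ^+ N)%R]/((NngNum C0)%:num)%R -ge0_integral_mscale//;
  last by move=> x _; rewrite lee_fin.
apply: ge0_le_measure_integral => //= A mA.
apply: le_trans (outer_image_lipschitz _ L0 lS).
by apply: le_outer_measure => w /= Aw; exists (q w) => //; exact: qS.
Qed.

End pushforward.

(** * The Euclidean norm *)

Section enorm_theory.
Context {R : realType} {N : nat}.
Local Notation V := 'rV[R]_N.
Implicit Types (x y : V).

Lemma cauchy_schwarz (a b : 'I_N -> R) :
  (\sum_i a i * b i) ^+ 2 <= (\sum_i a i ^+ 2) * (\sum_i b i ^+ 2).
Proof.
set A := \sum_i a i ^+ 2; set B := \sum_i a i * b i; set D := \sum_i b i ^+ 2.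
have A0 : 0 <= A by apply: sumr_ge0 => i _; exact: sqr_ge0.
have [A_eq0|A_neq0] := eqVneq A 0.
  rewrite /B big1 ?expr0n ?A_eq0 ?mul0r// => i _.
  have /eqP := A_eq0; rewrite psumr_eq0; last by move=> j _; exact: sqr_ge0.
  move=> /allP/(_ i); rewrite mem_index_enum sqrf_eq0 => /(_ isT)/eqP ->.
  by rewrite mul0r.
(* Expanded, this is [A * (A * D - B ^+ 2)], and [A > 0] cancels. *)
have : 0 <= \sum_i (A * b i - B * a i) ^+ 2.
  by apply: sumr_ge0 => i _; exact: sqr_ge0.
have -> : \sum_i (A * b i - B * a i) ^+ 2 = A * (A * D - B ^+ 2).
  rewrite (eq_bigr (fun i => A ^+ 2 * b i ^+ 2 - 2 * A * B * (a i * b i)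
    + B ^+ 2 * a i ^+ 2)); last by move=> i _; ring.
  by rewrite big_split/= sumrB -!mulr_sumr -/A -/B -/D; ring.
by rewrite pmulr_rge0 ?lt_neqAle 1?eq_sym ?A_neq0// subr_ge0.
Qed.

Lemma enorm_ge0 x : 0 <= enorm x.
Proof. exact: sqrtr_ge0. Qed.

Lemma enorm_sqr x : enorm x ^+ 2 = \sum_i x ord0 i ^+ 2.
Proof. by rewrite sqr_sqrtr// sumr_ge0// => i _; exact: sqr_ge0. Qed.

Lemma enormZ (k : R) x : enorm (k *: x) = `|k| * enorm x.
Proof.
rewrite /enorm -sqrtr_sqr -sqrtrM ?sqr_ge0//; congr Num.sqrt.
by rewrite mulr_sumr; apply: eq_bigr => i _; rewrite mxE exprMn.
Qed.

Lemma enorm0 : enorm (0 : V) = 0.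
Proof. by rewrite -(scale0r 0) enormZ normr0 mul0r. Qed.

Lemma enorm_distC x y : enorm (x - y) = enorm (y - x).
Proof. by rewrite -opprB -scaleN1r enormZ normrN1 mul1r. Qed.

Lemma enormD x y : enorm (x + y) <= enorm x + enorm y.
Proof.
rewrite -(@ler_pXn2r _ 2)// ?nnegrE ?enorm_ge0 ?addr_ge0 ?enorm_ge0//.
rewrite sqrrD !enorm_sqr.
rewrite (eq_bigr (fun i => x ord0 i ^+ 2 + 2 * (x ord0 i * y ord0 i)
  + y ord0 i ^+ 2)); last by move=> i _; rewrite mxE; ring.
rewrite !big_split/= lerD2r lerD2l -mulr_sumr -[leRHS]mulr_natl ler_wpM2l//.
apply: le_trans (ler_norm _) _.
rewrite -(@ler_pXn2r _ 2)// ?nnegrE ?mulr_ge0 ?enorm_ge0//.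
by rewrite real_normK ?num_real// exprMn !enorm_sqr cauchy_schwarz.
Qed.

Lemma enorm_lip x y : `|enorm x - enorm y| <= enorm (x - y).
Proof.
have := enormD (x - y) y; have := enormD (y - x) x.
by rewrite !subrK (enorm_distC y) ler_norml; lra.
Qed.

Lemma coord_le_enorm x i : `|x ord0 i| <= enorm x.
Proof.
rewrite -(@ler_pXn2r _ 2)// ?nnegrE ?enorm_ge0//.
rewrite real_normK ?num_real// enorm_sqr (bigD1 i)//= lerDl.
by apply: sumr_ge0 => j _; exact: sqr_ge0.
Qed.

(** The factor [N.+1] is larger than the sharp [sqrt N], but it keeps the inequality strict for
    [N = 0]. *)
Lemma enorm_lt x (s : R) : 0 < s -> (forall i, `|x ord0 i| < s) ->
  enorm x < N.+1%:R * s.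
Proof.
move=> s0 xs.
rewrite -(@ltr_pXn2r _ 2)// ?nnegrE ?enorm_ge0 ?mulr_ge0 ?ltW//.
apply: (@le_lt_trans _ _ (\sum_(i < N) s ^+ 2)).
  rewrite enorm_sqr ler_sum// => i _.
  by rewrite -(real_normK (num_real (x ord0 i))) ler_pXn2r ?nnegrE// ltW.
rewrite sumr_const card_ord -[ltLHS]mulr_natl exprMn ltr_pM2r ?exprn_gt0//.
rewrite -natrX ltr_nat expnS expn1 mulSn.
by apply: (@leq_trans N.+1) => //; rewrite leq_addr.
Qed.

(** This links the Euclidean norm to the topology, which comes from the sup norm. *)
Lemma near_enorm_lt x (d : R) : 0 < d -> \forall y \near x, enorm (x - y) < d.
Proof.
move=> d0; have e0 : 0 < d / N.+1%:R by rewrite divr_gt0.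
apply/nbhs_ballP; exists (d / N.+1%:R) => //= y [_ xy].
rewrite [ltRHS](_ : d = N.+1%:R * (d / N.+1%:R)); last first.
  by rewrite mulrCA divff ?mulr1// pnatr_eq0.
by apply: enorm_lt => // i; rewrite !mxE; exact: xy.
Qed.

Lemma near_lipschitz_lt (L : R) x (d : R) : 0 < d ->
  \forall y \near x, L * enorm (x - y) < d.
Proof.
move=> d0; have L0 : 0 < `|L| + 1 by rewrite ltr_wpDl.
have : \forall y \near x, enorm (x - y) < d / (`|L| + 1).
  by apply: near_enorm_lt; rewrite divr_gt0.
apply: filterS => y; rewrite ltr_pdivlMr// mulrC; apply: le_lt_trans.
rewrite ler_wpM2r ?enorm_ge0//; have := ler_norm L; lra.
Qed.

Lemma lipschitz_continuous (F : V -> V) (L : R) :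
  (forall x y, enorm (F x - F y) <= L * enorm (x - y)) -> continuous F.
Proof.
move=> FL x A /nbhs_ballP[e /= e0 eA].
apply: filterS (near_lipschitz_lt L x e0) => y xy; apply: eA; split => // i j.
rewrite ord1 /ball/=; apply: le_lt_trans (le_lt_trans (FL x y) xy).
by have := coord_le_enorm (F x - F y) j; rewrite !mxE.
Qed.

Lemma elipschitz_continuous (f : V -> R) : elipschitz f -> continuous f.
Proof.
move=> [L fL] x A /nbhs_ballP[e /= e0 eA].
apply: filterS (near_lipschitz_lt L x e0) => y xy.
by apply: eA; rewrite /ball/=; apply: le_lt_trans (fL x y) xy.
Qed.

Lemma enorm_continuous : continuous (@enorm R N).
Proof.
by apply: elipschitz_continuous; exists 1 => x y; rewrite mul1r; exact: enorm_lip.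
Qed.

Lemma closed_enorm_le (K : R) : closed [set x : V | enorm x <= K].
Proof.
apply: (@closed_comp _ _ (@enorm R N) [set y | y <= K]); last exact: closed_le.
by move=> y _; exact: enorm_continuous.
Qed.

Lemma compact_enorm_le (K : R) : compact [set x : V | enorm x <= K].
Proof.
apply: (@subclosed_compact _ _ [set x : V | forall i, `[- K, K]%classic (x ord0 i)]).
- exact: closed_enorm_le.
- by apply: (@rV_compact _ _ (fun=> `[- K, K]%classic)) => _; exact: segment_compact.
- move=> x /= xK i; rewrite in_itv/= -ler_norml.
  exact: le_trans (coord_le_enorm x i) xK.
Qed.

End enorm_theory.

(** * Radial contraction towards the origin and its Lipschitz inverse *)

Section retraction.
Context {R : realType} {N : nat}.
Local Notation V := 'rV[R]_N.
Implicit Types (x y w : V) (s r : R).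

Definition emax s w : R := Num.max (enorm w) s.

(** For [s > 0] this is the projection of [w] onto the closed ball of radius [s], divided by [s]. *)
Definition esat s w : V := (emax s w)^-1 *: w.

Lemma emax_ge s w : s <= emax s w.
Proof. by rewrite le_max lexx orbT. Qed.

Lemma enorm_le_emax s w : enorm w <= emax s w.
Proof. by rewrite le_max lexx. Qed.

Lemma emax_gt0 s w : 0 < s -> 0 < emax s w.
Proof. by move=> s0; rewrite lt_max s0 orbT. Qed.

Lemma emax_lip s x y : `|emax s x - emax s y| <= enorm (x - y).
Proof.
apply: le_trans (enorm_lip x y); rewrite /emax.
case: (leP (enorm x) s); case: (leP (enorm y) s) => ? ?; rewrite !ler_norml.
- by have := normr_ge0 (enorm x - enorm y); lra.
- have := ler_norm (enorm y - enorm x); rewrite distrC.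
  by have := normr_ge0 (enorm x - enorm y); lra.
- have := ler_norm (enorm x - enorm y).
  by have := normr_ge0 (enorm x - enorm y); lra.
- have := ler_norm (enorm y - enorm x); rewrite distrC.
  have := ler_norm (enorm x - enorm y); lra.
Qed.

Lemma esat_lip s x y : 0 < s ->
  enorm (esat s x - esat s y) <= 2 / s * enorm (x - y).
Proof.
move=> s0; have mx := emax_gt0 x s0; have my := emax_gt0 y s0.
(* The change of vector and the change of factor each contribute at most [s^-1 * enorm (x - y)]; the
   second one because [enorm y <= emax s y]. *)
have -> : esat s x - esat s y = (emax s x)^-1 *: (x - y) +
    ((emax s y - emax s x) / (emax s x * emax s y)) *: y.
  rewrite /esat scalerBr -addrA; congr (_ + _).
  rewrite -scaleNr -scalerDl -scaleNr; congr (_ *: _).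
  by field; rewrite !gt_eqF.
apply: le_trans (enormD _ _) _; rewrite !enormZ.
have sx : `|(emax s x)^-1| <= s^-1.
  by rewrite ger0_norm ?invr_ge0 ?(ltW mx)// lef_pV2 ?posrE// emax_ge.
have e0 := enorm_ge0 (x - y).
rewrite (_ : 2 / s * _ = s^-1 * enorm (x - y) + s^-1 * enorm (x - y)); last by ring.
apply: lerD; first by rewrite ler_wpM2r.
rewrite normrM -mulrA [`|_^-1|]ger0_norm ?invr_ge0 ?mulr_ge0 ?(ltW mx) ?(ltW my)//.
rewrite invfM (mulrC s^-1); apply: ler_pM => //.
- by rewrite !mulr_ge0 ?invr_ge0 ?(ltW mx) ?(ltW my)// enorm_ge0.
- by rewrite distrC emax_lip.
- rewrite -mulrA; apply: (@le_trans _ _ ((emax s x)^-1 * 1)).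
    rewrite ler_wpM2l ?invr_ge0 ?(ltW mx)// mulrC ler_pdivrMr// mul1r.
    exact: enorm_le_emax.
  by rewrite mulr1; move: sx; rewrite ger0_norm// invr_ge0 ltW.
Qed.

(* [pull r s w] minimizes [emax s] over the closed ball of radius [r] and
   centre [w]; for [|w| > r + s] it is [w - r w / |w|]. *)
Definition pull r s w : V := w - r *: esat (r + s) w.

(** Inverse of [pull]: it dilates the ball of radius [s] to radius [r + s] and moves the points
    outside it outwards by [r]. *)
Definition push r s w : V := w + r *: esat s w.

(** [pull] multiplies [w] by [1 - r / emax (r + s) w], which is nonnegative. If [enorm w > r + s]
    the norm drops by exactly [r]; otherwise both sides equal [s]. *)
Lemma emax_pull r s w : 0 <= r -> 0 < s ->
  emax s (pull r s w) = emax (r + s) w - r.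
Proof.
move=> r0 s0.
have M0 : 0 < emax (r + s) w by rewrite emax_gt0// ltr_wpDl.
have -> : pull r s w = (1 - r / emax (r + s) w) *: w.
  by rewrite /pull /esat scalerBl scale1r scalerA.
have rM : r / emax (r + s) w <= 1.
  by rewrite ler_pdivrMr// mul1r; apply: le_trans (emax_ge _ _); rewrite lerDl ltW.
rewrite {1}/emax enormZ ger0_norm ?subr_ge0//.
move: M0 rM; rewrite /emax; case: (leP (enorm w) (r + s)) => wrs M0 rM.
  rewrite max_r; first by ring.
  rewrite (_ : 1 - r / (r + s) = s / (r + s)); last by field; rewrite gt_eqF.
  by rewrite mulrAC ler_pdivrMr// ler_pM2l.
rewrite mulrBl mul1r divfK ?gt_eqF// max_l//; lra.
Qed.

(** With [M = emax (r + s) w], [emax_pull] gives [push] the factor [1 + r / (M - r) = M / (M - r)],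
    the inverse of the factor [1 - r / M] of [pull]. *)
Lemma pullK r s : 0 <= r -> 0 < s -> cancel (pull r s) (push r s).
Proof.
move=> r0 s0 w; rewrite /push /esat emax_pull//.
have M0 : 0 < emax (r + s) w by rewrite emax_gt0// ltr_wpDl.
have Mr : 0 < emax (r + s) w - r.
  by have := emax_ge (r + s) w; lra.
rewrite scalerA -[X in X + _]scale1r -scalerDl.
have -> : pull r s w = (1 - r / emax (r + s) w) *: w.
  by rewrite /pull /esat scalerBl scale1r scalerA.
rewrite scalerA -[RHS]scale1r; congr (_ *: _).
by field; rewrite !gt_eqF.
Qed.

Lemma enorm_pull r s w : 0 <= r -> 0 < s -> enorm (pull r s w - w) <= r.
Proof.
move=> r0 s0; rewrite /pull addrAC subrr add0r -scaleNr enormZ normrN.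
rewrite ger0_norm// /esat enormZ.
have M0 : 0 < emax (r + s) w by rewrite emax_gt0// ltr_wpDl.
rewrite ger0_norm ?invr_ge0 ?(ltW M0)//.
rewrite -[leRHS]mulr1 ler_wpM2l// mulrC ler_pdivrMr// mul1r.
exact: enorm_le_emax.
Qed.

(** By [emax_pull] the left side is the maximum of [enorm w - r] and [s], and
    [enorm w - r <= enorm y]. *)
Lemma emax_pull_le r s w y : 0 <= r -> 0 < s -> enorm (y - w) <= r ->
  emax s (pull r s w) <= emax s y.
Proof.
move=> r0 s0 yw; rewrite emax_pull//.
have wy : enorm w <= enorm y + r.
  have := enormD y (w - y); rewrite addrC subrK enorm_distC => /le_trans; apply.
  by rewrite lerD2l.
by rewrite /emax; case: (leP (enorm w) (r + s)); case: (leP (enorm y) s); lra.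
Qed.

Lemma pull_continuous r s : 0 <= r -> 0 < s -> continuous (pull r s).
Proof.
move=> r0 s0; have rs : 0 < r + s by rewrite ltr_wpDl.
apply: (@lipschitz_continuous _ _ _ (1 + r * (2 / (r + s)))) => x y.
have -> : pull r s x - pull r s y =
    (x - y) + r *: (esat (r + s) y - esat (r + s) x).
  apply/rowP => i; rewrite /pull; move: (esat _ x) (esat _ y) => a b.
  by rewrite !mxE; ring.
apply: le_trans (enormD _ _) _; rewrite enormZ ger0_norm// mulrDl mul1r lerD2l.
by rewrite -mulrA ler_wpM2l// (enorm_distC x) esat_lip.
Qed.

(** [1 + 2 * r / s] is a Euclidean Lipschitz constant, by [esat_lip]; [N.+1] is the price of passing
    from coordinates to the Euclidean norm. *)
Lemma push_sup_lipschitz r s : 0 <= r -> 0 < s ->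
  sup_lipschitz ((1 + 2 * r / s) * N.+1%:R) (@push r s).
Proof.
move=> r0 s0 x y d xy i.
have d0 : 0 < d by apply: le_lt_trans (xy i).
have C0 : 0 < 1 + 2 * r / s.
  by rewrite ltr_pwDl// divr_ge0 ?(ltW s0)// mulr_ge0.
apply: (@le_lt_trans _ _ ((1 + 2 * r / s) * enorm (x - y))); last first.
  rewrite -[ltRHS]mulrA ltr_pM2l// enorm_lt// => j; rewrite !mxE; exact: xy.
have -> : push r s x ord0 i - push r s y ord0 i = (push r s x - push r s y) ord0 i.
  by rewrite !mxE.
apply: le_trans (coord_le_enorm _ _) _.
have -> : push r s x - push r s y = (x - y) + r *: (esat s x - esat s y).
  apply/rowP => j; rewrite /push; move: (esat _ x) (esat _ y) => a b.
  by rewrite !mxE; ring.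
apply: le_trans (enormD _ _) _; rewrite enormZ ger0_norm// mulrDl mul1r lerD2l.
rewrite (_ : 2 * r / s * _ = r * (2 / s * enorm (x - y))); last by ring.
by rewrite ler_wpM2l// esat_lip.
Qed.

End retraction.

(** * Oscillation and lower integrals *)

Import HBNNSimple.

(* [f1] may be non-measurable: the integral of a nonnegative function is the
   supremum of the integrals of the simple functions below it. *)
Lemma ae_ge0_le_lower_integral d (T : measurableType d) (R : realType)
    (mu : {measure set T -> \bar R}) (f1 f2 : T -> \bar R) :
  (forall x, 0 <= f1 x)%E -> (forall x, 0 <= f2 x)%E ->
  measurable_fun [set: T] f2 -> {ae mu, forall x, f1 x <= f2 x}%E ->
  (\int[mu]_x f1 x <= \int[mu]_x f2 x)%E.
Proof.
move=> f10 f20 mf2 f12; rewrite [leLHS]ge0_integralTE//.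
apply: ge_ereal_sup => _ [h /= hf1 <-]; rewrite -integralT_nnsfun.
apply: ae_ge0_le_integral => //.
- by move=> x _; rewrite lee_fin; exact: fun_ge0.
- by apply/measurable_EFinP; exact: measurable_funP.
- by apply: filterS f12 => x f12x _; exact: le_trans (hf1 x) f12x.
Qed.

(* When the positive part of [G] has infinite integral, [Rintegral] is [0]. *)
Lemma ae_ge_Rintegral d (T : measurableType d) (R : realType)
    (mu : {measure set T -> \bar R}) (G f : T -> R) :
  (forall x, 0 <= f x) -> measurable_fun [set: T] f ->
  (\int[mu]_x (f x)%:E < +oo)%E -> {ae mu, forall x, - f x <= G x} ->
  - (\int[mu]_x f x) <= \int[mu]_x G x.
Proof.
move=> f0 mf foo fG.
have If0 : (0 <= \int[mu]_x (f x)%:E)%E.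
  by apply: integral_ge0 => x _; rewrite lee_fin.
rewrite /Rintegral [in leRHS]integralE.
set P := (\int[mu]_x ((fun x => (G x)%:E)^\+ x))%E.
set M := (\int[mu]_x ((fun x => (G x)%:E)^\- x))%E.
have M_le : (M <= \int[mu]_x (f x)%:E)%E.
  apply: ae_ge0_le_lower_integral => //.
  - exact/measurable_EFinP.
  - apply: filterS fG => x fGx.
    by rewrite funenegE -EFinN -[0%E]/(0%:E) -EFin_max lee_fin ge_max f0 andbT lerNl.
have M0 : (0 <= M)%E by apply: integral_ge0 => x _; exact: funeneg_ge0.
have P0 : (0 <= P)%E by apply: integral_ge0 => x _; exact: funepos_ge0.
have Mfin : M \is a fin_num by rewrite ge0_fin_numE// (le_lt_trans M_le).
rewrite -(fineK Mfin); move: P0; case: P => [p| |]//= P0; last first.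
  by rewrite oppr_le0 fine_ge0.
apply: (@le_trans _ _ (- fine M)); last by rewrite lerDr -lee_fin.
by rewrite lerN2 fine_le// ge0_fin_numE.
Qed.

Section resolvent_lemmas.
Context {R : realType} {N : nat}.
Local Notation V := 'rV[R]_N.
Local Notation borelVV := (g_sigma_algebraType (@open (V * V)%type)).
Implicit Types (w a b x : V) (r : R).

(** As [a] may lie on the boundary sphere, it is first moved towards [w] by the fraction [t]; a
    small box around the new point lies in the open ball, and [ae_box] applies to it. *)
Lemma ae_near_ball w a r (d : R) (P : V -> Prop) : 0 < r -> 0 < d ->
  enorm (a - w) <= r -> {ae lebesgueN, forall x, P x} ->
  exists x, [/\ P x, enorm (x - w) < r & enorm (x - a) < d].
Proof.
move=> r0 d0 awr aeP.
(* [t * r] bounds both the displacement of [a] and the distance from the new point to [x], so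
   [2 * t * r <= d] is required. *)
pose t : R := Num.min 1 (d / (2 * r)).
have t0 : 0 < t by rewrite lt_min ltr01 divr_gt0// mulr_gt0.
have t1 : t <= 1 by rewrite ge_min lexx.
have td : t * r * 2 <= d.
  by rewrite -mulrA (mulrC r) -ler_pdivlMr ?mulr_gt0// ge_min lexx orbT.
have tr0 : 0 < t * r by rewrite mulr_gt0.
pose at_ : V := w + (1 - t) *: (a - w).
pose e : R := t * r / N.+1%:R.
have e0 : 0 < e by rewrite divr_gt0.
(* Half-open boxes contain their lower faces; [e / 2] there keeps all coordinate distances strictly
   below [e]. *)
have [x xB Px] := @ae_box R N (\row_i (at_ ord0 i - e / 2)) (\row_i (at_ ord0 i + e)) P
   ltac:(by move=> i; rewrite !mxE; lra) aeP.
have xat : enorm (x - at_) < t * r.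
  rewrite [ltRHS](_ : _ = N.+1%:R * e); last first.
    by rewrite /e mulrCA divff ?mulr1// pnatr_eq0.
  apply: enorm_lt => // i; move: (at_) xB => p /(_ i).
  by rewrite /= !mxE ltr_norml; lra.
exists x; split => //.
- rewrite (_ : x - w = (x - at_) + (1 - t) *: (a - w)); last first.
    by rewrite /at_ opprD addrA addrNK.
  apply: le_lt_trans (enormD _ _) _; rewrite enormZ ger0_norm ?subr_ge0//.
  have : (1 - t) * enorm (a - w) <= (1 - t) * r by rewrite ler_wpM2l// subr_ge0.
  lra.
- rewrite (_ : x - a = (x - at_) + t *: (w - a)); last first.
    by apply/rowP => i; rewrite /at_ !mxE; ring.
  apply: le_lt_trans (enormD _ _) _; rewrite enormZ ger0_norm ?(ltW t0)//.
  have : t * enorm (w - a) <= t * r by rewrite ler_wpM2l ?(ltW t0)// enorm_distC.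
  lra.
Qed.

Lemma elipschitz_near (u : V -> R) a (e : R) : elipschitz u -> 0 < e ->
  exists2 d, 0 < d & forall x, enorm (x - a) < d -> `|u x - u a| < e.
Proof.
move=> [L uL] e0; have L0 : 0 < `|L| + 1 by rewrite ltr_wpDl.
exists (e / (`|L| + 1)); first by rewrite divr_gt0.
move=> x; rewrite ltr_pdivlMr// mulrC; apply: le_lt_trans.
apply: le_trans (uL x a) _; rewrite ler_wpM2r ?enorm_ge0//.
have := ler_norm L; lra.
Qed.

Lemma ess_sup_on_ge (u : V -> R) w a r : elipschitz u -> 0 < r ->
  enorm (a - w) <= r -> ((u a)%:E <= ess_sup_on (eball w r) u)%E.
Proof.
move=> ul r0 awr; apply: le_ereal_inf_tmp => y /= uy.
apply/lee_addgt0Pr => e e0; have [d d0 ud] := elipschitz_near a ul e0.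
have [x [uxy xw xa]] := ae_near_ball r0 d0 awr uy.
apply: (@le_trans _ _ ((u x)%:E + e%:E)%E); last by rewrite leeD2r// uxy.
by rewrite -EFinD lee_fin; have := ud x xa; rewrite ltr_norml; lra.
Qed.

Lemma ess_inf_on_le (u : V -> R) w a r : elipschitz u -> 0 < r ->
  enorm (a - w) <= r -> (ess_inf_on (eball w r) u <= (u a)%:E)%E.
Proof.
move=> ul r0 awr; apply: ge_ereal_sup => y /= uy.
apply/lee_addgt0Pr => e e0; have [d d0 ud] := elipschitz_near a ul e0.
have [x [uxy xw xa]] := ae_near_ball r0 d0 awr uy.
apply: le_trans (uxy xw) _.
by rewrite -EFinD lee_fin; have := ud x xa; rewrite ltr_norml; lra.
Qed.

(** The measures live on closed balls, the oscillation on open ones: by continuity essential bounds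
    on the open ball hold at every point of its closure. *)
Lemma le_osc (u : V -> R) w a b r : elipschitz u -> 0 < r ->
  enorm (a - w) <= r -> enorm (b - w) <= r ->
  ((u a - u b)%:E <= osc (eball w r) u)%E.
Proof.
move=> ul r0 aw bw; rewrite EFinB.
by apply: leeB; [exact: ess_sup_on_ge | exact: ess_inf_on_le].
Qed.

Lemma closed_Cr r : closed (Cr r : set (V * V)).
Proof.
apply: closedI; apply: closed_comp; rewrite //; try exact: closed_closure.
- by move=> x _; exact: cvg_fst.
- by move=> x _; exact: cvg_snd.
Qed.

Lemma Cr_le r (p : V * V) : Cr r p -> enorm p.1 <= r /\ enorm p.2 <= r.
Proof.
suff H (x : V) : closure (eball 0 r) x -> enorm x <= r.
  by case=> /= /H ? /H ?.
move=> xr; suff : [set x : V | enorm x <= r] x by [].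
rewrite ((closure_id _).1 (@closed_enorm_le R N r)); apply: closure_subset xr => y /=.
by rewrite /eball/= subr0; exact: ltW.
Qed.

Lemma measurable_Cr r : measurable (Cr r : set borelVV).
Proof.
rewrite -[Cr r]setCK; apply: measurableC; apply: sub_sigma_algebra.
by apply: closed_openC; exact: closed_Cr.
Qed.

Lemma integrable_translate_diff (z : {finite_measure set borelVV -> \bar R})
    (f : V -> R) r w (B : R) : continuous f ->
  (forall p, Cr r p -> `|f (w + p.1) - f (w + p.2)| <= B) ->
  z.-integrable (Cr r) (fun p => (f (w + p.1) - f (w + p.2))%:E).
Proof.
move=> cf fB.
apply: (@measurable_bounded_integrable _ _ _ _
   (fun p : borelVV => f (w + p.1) - f (w + p.2))).
- exact: measurable_Cr.
- by rewrite ltey_eq fin_num_measure//; exact: measurable_Cr.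
- apply: (@measurable_funS _ _ _ _ setT) => //.
  apply: measurable_fun_preopen => U oU; apply: sub_sigma_algebra.
  suff : continuous (fun p : V * V => f (w + p.1) - f (w + p.2)).
    by move=> /continuousP; exact.
  move=> p; apply: (@continuousB _ R).
  + apply: (@continuous_comp _ _ _ (fun p : V * V => w + p.1) f); last exact: cf.
    by apply: continuousD; [exact: cst_continuous | exact: cvg_fst].
  + apply: (@continuous_comp _ _ _ (fun p : V * V => w + p.2) f); last exact: cf.
    by apply: continuousD; [exact: cst_continuous | exact: cvg_snd].
- exists B; split; first exact: num_real.
  by move=> x Bx p /= Cp; apply: le_trans (fB p Cp) (ltW Bx).
Qed.

End resolvent_lemmas.

(** * Comparison with a barrier *)

Section comparison.
Context {R : realType} {N : nat}.
Local Notation V := 'rV[R]_N.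
Local Notation mu := (@lebesgueN R N).
Local Notation borelVV := (g_sigma_algebraType (@open (V * V)%type)).
Implicit Types (w a b x y : V) (r s h c : R).

Lemma lebesgueN_enorm_le (K : R) : (mu [set x | (enorm x <= K)%R] < +oo)%E.
Proof.
pose B : V * V := (const_mx (- K), const_mx (K + 1)).
apply: (@le_lt_trans _ _ (mu (box B))).
  apply: le_outer_measure => x /= xK i; rewrite /= !mxE.
  by have := le_trans (coord_le_enorm x i) xK; rewrite ler_norml; lra.
exact: le_lt_trans (outer_le_boxvol B) (ltry _).
Qed.

Lemma integrable_compact_support (f : V -> R) (K : R) : continuous f ->
  (forall x, f x != 0 -> enorm x <= K) -> mu.-integrable setT (EFin \o f).
Proof.
move=> cf fK; pose A := [set x : V | enorm x <= K].
have mA : measurable (A : set (caratheodory_type (@lebesgueN_outer R N))).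
  rewrite -(setCK A); apply: measurableC; apply: measurable_openN.
  exact/closed_openC/closed_enorm_le.
rewrite (_ : EFin \o f = (EFin \o f) \_ A); last first.
  apply/funext => x; rewrite patchE; case: ifPn => // /negP xA /=.
  have [->//|/fK xK] := eqVneq (f x) 0.
  by exfalso; apply: xA; rewrite inE.
apply: (@integrable_mkcond _ _ _ mu A (EFin \o f) mA).1.
apply: measurable_bounded_integrable => //.
- exact: lebesgueN_enorm_le.
- by apply: measurable_funS (measurable_continuousN cf).
- have /compact_bounded[M [Mr fM]] : compact (f @` A).
    apply: continuous_compact; last exact: compact_enorm_le.
    exact: continuous_subspaceT.
  exists M; split => // y My x Ax; apply: (fM y My); by exists x.
Qed.

Lemma continuous_ae_eq0 (f : V -> R) : continuous f -> (forall x, 0 <= f x) ->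
  {ae mu, forall x, f x = 0} -> forall x, f x = 0.
Proof.
move=> cf f0 aef x; apply/eqP; rewrite eq_le f0 andbT leNgt; apply/negP => fx.
have /nbhs_ballP[e /= e0 eB] : nbhs x (f @^-1` [set y | 0 < y]).
  apply: open_nbhs_nbhs; split => //.
  by move/continuousP : cf; apply; exact: open_gt.
have [y yB fy] := @ae_box R N (\row_i (x ord0 i - e / 2)) (\row_i (x ord0 i + e)) _
  ltac:(by move=> i; rewrite !mxE; lra) aef.
suff : 0 < f y by rewrite fy ltxx.
apply: eB; split => // i j; rewrite ord1 /ball/= ltr_distlC.
by have := yB j; rewrite /= !mxE; lra.
Qed.

(** With [f] the positive part of [u - v] and [O] the oscillation, [key] bounds [f a - f b] from
    below by [u a - u b - (O + f q)] on the closed ball. The integral of [u a - u b] is [O] and the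
    mass is at most 1, so [- f q] remains. *)
Lemma Rintegral_excess_ge (z : {finite_measure set borelVV -> \bar R})
    (u v : V -> R) r w q :
  0 < r -> elipschitz u -> continuous v -> enorm (q - w) <= r ->
  (forall b, enorm (b - w) <= r -> v q <= v b) ->
  (z (Cr r) <= 1)%E ->
  (\int[z]_(p in Cr r) (u (w + p.1) - u (w + p.2))%:E)%E = osc (eball w r) u ->
  - Num.max 0 (u q - v q) <= \int[z]_(p in Cr r)
     (Num.max 0 (u (w + p.1) - v (w + p.1))
      - Num.max 0 (u (w + p.2) - v (w + p.2))).
Proof.
move=> r0 ul cv qw vq z1 zu.
have cu := elipschitz_continuous ul.
pose f x := Num.max 0 (u x - v x).
have cf : continuous f.
  move=> x; apply: (@continuous_max _ _ (cst 0) (u \- v)).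
    exact: cst_continuous.
  by apply: (@continuousB _ R^o); [exact: cu | exact: cv].
have inball p : Cr r p -> enorm (w + p.1 - w) <= r /\ enorm (w + p.2 - w) <= r.
  by move=> /Cr_le; rewrite !(addrC w) !addrK.
have iu : z.-integrable (Cr r) (fun p => (u (w + p.1) - u (w + p.2))%:E).
  have [L uL] := ul.
  apply: (@integrable_translate_diff _ _ _ _ _ _ (`|L| * (r + r)) cu) => p /Cr_le[p1 p2].
  apply: le_trans (uL _ _) _.
  apply: le_trans (ler_wpM2r (enorm_ge0 _) (ler_norm L)) _.
  rewrite ler_wpM2l// opprD addrACA subrr add0r.
  apply: le_trans (enormD _ _) _.
  by rewrite -(sub0r p.2) enorm_distC subr0 lerD.
have Ofin : osc (eball w r) u \is a fin_num.
  by rewrite -zu; apply: integrable_fin_num => //; exact: measurable_Cr.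
pose O := fine (osc (eball w r) u).
have uO a b : enorm (a - w) <= r -> enorm (b - w) <= r -> u a - u b <= O.
  by move=> aw bw; rewrite -lee_fin /O (fineK Ofin); exact: le_osc.
have O0 : 0 <= O by have := uO q q qw qw; rewrite subrr.
have f0 x : 0 <= f x by rewrite le_max lexx.
(* This bound serves only the integrability of the differences of [f]. *)
have fO b : enorm (b - w) <= r -> f b <= f q + O.
  move=> bw; rewrite {1}/f ge_max addr_ge0 ?f0//=.
  have : u q - v q <= f q by rewrite le_max lexx orbT.
  by rewrite -/(f q); have := uO _ _ bw qw; have := vq _ bw; lra.
have ff : z.-integrable (Cr r) (fun p => (f (w + p.1) - f (w + p.2))%:E).
  apply: (@integrable_translate_diff _ _ _ _ _ _ (f q + O) cf) => p /inball[p1 p2].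
  move: (f0 (w + p.1)) (f0 (w + p.2)) (fO _ p1) (fO _ p2).
  by rewrite ler_norml; lra.
(* If [f] vanishes at the second point, the left side is at most 0. Otherwise [u] at the first point
   is at most [u q + O], and [u q - f q <= v q], which is at most [v] at the second point. *)
have key p : Cr r p ->
    u (w + p.1) - u (w + p.2) - (O + f q) <= f (w + p.1) - f (w + p.2).
  move=> /inball[p1 p2].
  have : u q - v q <= f q by rewrite le_max lexx orbT.
  have : u (w + p.1) - v (w + p.1) <= f (w + p.1) by rewrite le_max lexx orbT.
  have := f0 (w + p.1); have := f0 q.
  have := uO _ _ p1 p2; have := uO _ _ p1 qw; have := vq _ p2.
  have : f (w + p.2) = 0 \/ f (w + p.2) = u (w + p.2) - v (w + p.2).
    by rewrite /f; case: leP; [right | left].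
  by move=> [] ->; lra.
have icst : z.-integrable (Cr r) (EFin \o cst (O + f q)).
  apply: (@measurable_bounded_integrable _ _ _ _ (cst (O + f q))).
  - exact: measurable_Cr.
  - exact: le_lt_trans z1 (ltry _).
  - exact: measurable_cst.
  - by exists (`|O + f q|); split=> [|M ltM p _]; rewrite ?num_real//= ltW.
have zC : 0 <= fine (z (Cr r)) <= 1.
  by rewrite fine_ge0//= -lee_fin fineK ?fin_num_measure//; exact: measurable_Cr.
apply: le_trans (le_Rintegral (measurable_Cr r) _ ff key); last first.
  by apply: (integrableB (measurable_Cr r) iu icst).
rewrite (RintegralB (measurable_Cr r) iu icst) Rintegral_cst; last first.
  exact: measurable_Cr.
rewrite [X in _ <= X - _](_ : _ = O); last by rewrite /Rintegral zu.
have : (O + f q) * fine (z (Cr r)) <= (O + f q) * 1.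
  by case/andP: zC => _ zC; rewrite ler_wpM2l// addr_ge0.
by rewrite mulr1 -/(f q); lra.
Qed.

End comparison.

(** * Bounding the resolvent by a barrier *)

Section core.
Context {R : realType} {N : nat}.
Local Notation V := 'rV[R]_N.
Local Notation mu := (@lebesgueN R N).
Implicit Types (w a b x y : V) (r s h c e : R).

Definition barrier s c e x : R := emax s x + c + e * emax s x ^+ 2.

Lemma barrier_continuous s c e : continuous (barrier s c e).
Proof.
have cm : continuous (@emax R N s).
  by apply: elipschitz_continuous; exists 1 => x y; rewrite mul1r; exact: emax_lip.
have -> : barrier s c e = ((emax s \+ cst c) \+ (cst e \* (emax s \* emax s))).
  by apply/funext => x; rewrite /barrier expr2.
move=> x; apply: (@continuousD R R V).
  by apply: (@continuousD R R V); [exact: cm | exact: cst_continuous].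
by apply: continuousM; [exact: cst_continuous | apply: continuousM; exact: cm].
Qed.

Lemma barrier_ge s c e x : 0 <= e -> enorm x + c <= barrier s c e x.
Proof.
move=> e0; rewrite /barrier -[leLHS]addr0 lerD ?lerD2r ?enorm_le_emax//.
by rewrite mulr_ge0 ?sqr_ge0.
Qed.

(** A Lipschitz function grows at most linearly, the barrier quadratically. *)
Lemma barrier_excess_bounded (u : V -> R) s c e : elipschitz u ->
  0 < s -> 0 <= c -> 0 < e ->
  exists K, forall x, barrier s c e x < u x -> enorm x <= K.
Proof.
(* The summand 1 ensures [1 <= enorm x], so that the constant [u 0] is absorbed into a linear
   term. *)
move=> [L uL] s0 c0 e0; exists ((`|u 0| + `|L|) / e + 1) => x.
apply: contraTT; rewrite -ltNge -leNgt => Kx.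
have K0 : 0 <= (`|u 0| + `|L|) / e by rewrite divr_ge0 ?addr_ge0 ?(ltW e0).
have x1 : 1 <= enorm x by lra.
have ux : u x <= `|u 0| + `|L| * enorm x.
  have := uL x 0; rewrite subr0 => uLx.
  have := ler_norm (u x - u 0); have := ler_norm (u 0).
  have : L * enorm x <= `|L| * enorm x by rewrite ler_wpM2r ?enorm_ge0 ?ler_norm.
  lra.
apply: le_trans ux _.
have xm := enorm_le_emax s x.
have : e * enorm x ^+ 2 <= e * emax s x ^+ 2.
  by rewrite ler_pM2l// ler_pXn2r// nnegrE ?enorm_ge0// (le_trans (enorm_ge0 x)).
have : (`|u 0| + `|L|) * enorm x <= e * enorm x ^+ 2.
  rewrite expr2 mulrA ler_pM2r ?(lt_le_trans _ x1)//.
  by rewrite -ler_pdivrMl// mulrC; lra.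
have : `|u 0| * 1 <= `|u 0| * enorm x by rewrite ler_wpM2l.
have := enorm_ge0 x; rewrite /barrier mulrDl; lra.
Qed.

(** The value of [c] is what closes the estimate: [h / (2 * r)] is the weight of the divergence
    term, and the power is the constant of [integral_comp_expansion] for [push r s]. *)
Lemma resolvent_le_barrier r h s e (phi : V -> R) : 0 < r -> 0 < h -> 0 < s ->
  0 < e -> is_resolvent r h (@enorm R N) phi ->
  let c := h / (2 * r) * (4 * ((1 + 2 * r / s) * N.+1%:R)) ^+ N in
  forall x, phi x <= barrier s c e x.
Proof.
move=> r0 h0 s0 e0 [[ul _] [z [_ z1 zu eqz]]] c.
set C := (4 * _) ^+ N in c *.
have L0 : 0 < (1 + 2 * r / s) * N.+1%:R.
  by rewrite mulr_gt0// ltr_pwDl// divr_ge0 ?(ltW s0)// mulr_ge0// ltW.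
have C0 : 0 < C by rewrite exprn_gt0// mulr_gt0.
have hr0 : 0 < h / (2 * r) by rewrite divr_gt0// mulr_gt0.
have c0 : 0 < c by rewrite mulr_gt0.
set v := barrier s c e.
have cu := elipschitz_continuous ul.
have cv : continuous v := @barrier_continuous s c e.
pose f x := Num.max 0 (phi x - v x).
have cf : continuous f.
  move=> x; apply: (@continuous_max _ _ (cst 0) (phi \- v)).
    exact: cst_continuous.
  by apply: (@continuousB R R V); [exact: cu | exact: cv].
have f0 x : 0 <= f x by rewrite le_max lexx.
have fgt x : f x != 0 -> f x = phi x - v x /\ v x < phi x.
  rewrite /f; case: (leP 0 (phi x - v x)); last by rewrite eqxx.
  by rewrite le_eqVlt => /predU1P[<-|]; rewrite ?eqxx ?subr_gt0.
have [K uK] := barrier_excess_bounded ul s0 (ltW c0) e0.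
have fK x : f x != 0 -> enorm x <= K by move=> /fgt[_]; exact: uK.
have intM (g : V -> R) : continuous g -> mu.-integrable setT (EFin \o (g \* f)).
  move=> cg; apply: (@integrable_compact_support _ _ _ K).
    by move=> x; apply: (@continuousM R V); [exact: cg | exact: cf].
  by move=> x; rewrite /= mulf_eq0 negb_or => /andP[_]; exact: fK.
have intf : mu.-integrable setT (EFin \o f).
  exact: integrable_compact_support cf fK.
have Ccf : Cc f.
  split => //; apply: (@subclosed_compact _ _ [set x | enorm x <= K]).
  - exact: closed_closure.
  - exact: compact_enorm_le.
  - rewrite ((closure_id _).1 (@closed_enorm_le R N K)).
    by apply: closure_subset => x; exact: fK.
pose q := @pull R N r s.
have cq : continuous q by exact: pull_continuous (ltW r0) s0.
have cfq : continuous (f \o q).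
  by move=> x; apply: continuous_comp; [exact: cq | exact: cf].
have vq w b : enorm (b - w) <= r -> v (q w) <= v b.
  move=> bw; have m := emax_pull_le (ltW r0) s0 bw.
  rewrite /v /barrier lerD// ?lerD2r// ler_pM2l//.
  rewrite ler_pXn2r// nnegrE ltW// emax_gt0//.
have Ifq := integral_comp_expansion L0 (push_sup_lipschitz (ltW r0) s0)
  (pullK (ltW r0) s0) cq cf f0.
have If0 : (0 <= \int[mu]_w (f w)%:E)%E.
  by apply: integral_ge0 => x _; rewrite lee_fin.
have Ifoo : (\int[mu]_w (f w)%:E)%E \is a fin_num.
  exact: integrable_fin_num intf.
have Ifqoo : (\int[mu]_w (f (q w))%:E < +oo)%E.
  by apply: le_lt_trans Ifq _; rewrite -(fineK Ifoo) -EFinM ltry.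
(* The bound of [Rintegral_excess_ge] on each ball is integrated over [w]; measurability is asked
   only of [f \o q], which is continuous. *)
have G_ge : - (\int[mu]_w f (q w)) <= \int[mu]_w
    \int[z w]_(p in Cr r) (f (w + p.1) - f (w + p.2)).
  apply: ae_ge_Rintegral => //.
  - exact: measurable_continuousN cfq.
  - apply: (@filterS2 _ _ (ae_filter_ringOfSetsType mu) _ _ _ _ z1 zu) => w z1w zuw.
    apply: Rintegral_excess_ge => //.
    + exact: enorm_pull (ltW r0) s0.
    + by move=> b; exact: vq.
have fq_le : \int[mu]_w f (q w) <= C * \int[mu]_w f w.
  rewrite -lee_fin EFinM /Rintegral (fineK Ifoo) fineK//.
  rewrite ge0_fin_numE//; apply: integral_ge0 => x _; rewrite lee_fin; exact: f0.
have := eqz f Ccf; rewrite /nldiv; set G := \int[mu]_w \int[z w]_(p in _) _ in G_ge *.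
have -> : - h * (- (2 * r)^-1 * G) = h / (2 * r) * G by ring.
move=> eqf.
(* Where [f] is positive, [phi - enorm - c] is at least [phi - v = f]; so [F] dominates [f ^+ 2],
   and [F = 0] will force [f = 0]. *)
pose F x := (phi x - enorm x - c) * f x.
have F_ge x : f x ^+ 2 <= F x.
  have [fx|fx] := eqVneq (f x) 0; first by rewrite /F fx expr0n mulr0.
  have [fE vx] := fgt x fx.
  rewrite /F expr2 ler_wpM2r// fE.
  by rewrite -addrA -opprD lerD2l lerN2; exact: barrier_ge (ltW e0).
have F0 x : 0 <= F x by apply: le_trans (F_ge x); exact: sqr_ge0.
have cu1 : continuous (fun x => phi x - enorm x - c).
  move=> x; apply: (@continuousB R R V); last exact: cst_continuous.
  by apply: (@continuousB R R V); [exact: cu | exact: enorm_continuous].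
have cF : continuous F.
  by move=> x; apply: (@continuousM R V); [exact: cu1 | exact: cf].
have iF : mu.-integrable setT (EFin \o F) by exact: intM cu1.
have FE : \int[mu]_w F w = \int[mu]_w (phi w * f w) - \int[mu]_w (enorm w * f w)
    - c * \int[mu]_w f w.
  have cu2 : continuous (fun x => phi x - enorm x).
    by move=> x; apply: (@continuousB R R V); [exact: cu | exact: enorm_continuous].
  transitivity (\int[mu]_w ((phi w - enorm w) * f w) - \int[mu]_w (c * f w)).
    rewrite -RintegralB//; last 2 first.
    - exact: intM cu2.
    - by apply: (intM (cst c)); exact: cst_continuous.
    by apply: eq_Rintegral => x _; rewrite -mulrBl.
  rewrite RintegralZl//; congr (_ - _).
  rewrite -RintegralB//; last 2 first.
  - exact: intM cu.
  - exact: intM enorm_continuous.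
  by apply: eq_Rintegral => x _; rewrite -mulrBl.
(* By the tested equation the integral is [- h / (2 * r) * G] minus [c] times the integral of [f].
   Since [- G] is at most [C] times that integral, the choice of [c] makes the sum nonpositive. *)
have FI : \int[mu]_w F w = 0.
  apply/eqP; rewrite eq_le Rintegral_ge0 ?andbT; last by move=> x _; exact: F0.
  rewrite FE -eqf [X in X - _](_ : _ = - (h / (2 * r) * G)); last by ring.
  rewrite subr_le0 lerNl /c -mulrA -mulrN ler_pM2l//.
  by apply: le_trans G_ge; rewrite lerN2.
have aeF : {ae mu, forall x, F x = 0}.
  have mF : measurable_fun [set: caratheodory_type (@lebesgueN_outer R N)] (EFin \o F).
    by apply/measurable_EFinP; exact: measurable_continuousN cF.
  have /(ae_eq_integral_abs mu measurableT mF) :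
      (\int[mu]_x `|(EFin \o F) x|)%E = 0%E.
    transitivity ((\int[mu]_x F x)%:E); last by rewrite FI.
    rewrite /Rintegral fineK; last exact: integrable_fin_num iF.
    by apply: eq_integral => x _ /=; rewrite ger0_norm.
  apply: (@filterS _ _ (ae_filter_ringOfSetsType mu)) => x /(_ I) [].
  exact.
move=> x; have Fx := continuous_ae_eq0 cF F0 aeF x.
have : f x ^+ 2 <= 0 by rewrite -Fx.
rewrite le_eqVlt ltNge sqr_ge0 orbF sqrf_eq0 => /eqP fx.
by rewrite -subr_le0 -fx le_max lexx orbT.
Qed.

Lemma resolvent_le r h s (phi : V -> R) : 0 < r -> 0 < h -> 0 < s ->
  is_resolvent r h (@enorm R N) phi ->
  forall x, phi x <= Num.max (enorm x) s +
    h / (2 * r) * (4 * ((1 + 2 * r / s) * N.+1%:R)) ^+ N.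
Proof.
move=> r0 h0 s0 Hphi x; apply/ler_addgt0Pr => e e0.
have m0 : 0 < emax s x ^+ 2 by rewrite exprn_gt0// emax_gt0.
(* With this parameter, which depends on [x], the quadratic term equals [e] at [x]. *)
have := resolvent_le_barrier r0 h0 s0 (divr_gt0 e0 m0) Hphi x.
by rewrite /barrier divfK ?gt_eqF.
Qed.

End core.

(** * Choice of the truncation radius [s] *)

Theorem proposition3p11 (R : realType) (N : nat) (r : R) (r_gt0 : 0 < r) :
  (forall eta : R, 0 < eta ->
     exists c0 h0 : R, [/\ 0 < c0, 0 < h0 &
       forall h : R, 0 < h -> h <= h0 ->
       forall phi : 'rV[R]_N -> R, is_resolvent r h enorm phi ->
       forall w : 'rV[R]_N,
         phi w <= Num.max (enorm w + c0 * h) eta]) /\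
  (forall alpha : R, 0 < alpha -> alpha < 1 / (N%:R + 1) ->
     exists2 h1 : R, 0 < h1 &
       forall h : R, 0 < h -> h <= h1 ->
       forall phi : 'rV[R]_N -> R, is_resolvent r h enorm phi ->
         phi 0 <= 2 * (h `^ alpha)).
Proof.
have r2 : 0 < 2 * r by rewrite mulr_gt0.
split=> [eta eta0|alpha alpha0 alphaN].
  have s0 : 0 < eta / 2 by rewrite divr_gt0.
  pose c0 := (4 * ((1 + 2 * r / (eta / 2)) * N.+1%:R)) ^+ N / (2 * r).
  have c00 : 0 < c0.
    rewrite divr_gt0// exprn_gt0// mulr_gt0// mulr_gt0// ltr_pwDl//.
    by rewrite divr_ge0// ltW.
  (* This threshold gives [c0 * h <= eta / 2], so the bound is at most [eta] where
     [enorm w <= eta / 2]. *)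
  exists c0, (eta / 2 / c0); split => //; first by rewrite divr_gt0.
  move=> h h0; rewrite ler_pdivlMr// mulrC => hc phi Hphi w.
  apply: le_trans (resolvent_le r_gt0 h0 s0 Hphi w) _.
  have -> : h / (2 * r) * (4 * ((1 + 2 * r / (eta / 2)) * N.+1%:R)) ^+ N = c0 * h.
    by rewrite /c0; ring.
  rewrite le_max; case: (leP (enorm w) (eta / 2)) => _; last by rewrite lexx.
  apply/orP; right; lra.
(* For [s <= 1], [K / s] dominates the base of the power in [resolvent_le]. *)
pose K : R := 4 * ((1 + 2 * r) * N.+1%:R).
have K0 : 0 < K by rewrite !mulr_gt0// ltr_pwDl// ltW.
(* With [s = h ^ alpha], [h / s ^+ N] is [h ^ beta * s]: the condition on [alpha] is exactly that
   [beta] is positive. *)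
pose beta := 1 - alpha * N.+1%:R.
have beta0 : 0 < beta.
  by rewrite subr_gt0 -ltr_pdivlMr// -natr1.
pose D := 2 * r / K ^+ N.
have D0 : 0 < D by rewrite divr_gt0// exprn_gt0.
(* The bound 1 gives [s <= 1]; the other gives [h ^ beta <= D], which makes the additive constant at
   most [s]. *)
exists (Num.min 1 (D `^ beta^-1)); first by rewrite lt_min ltr01 powR_gt0.
move=> h h0; rewrite le_min => /andP[h1 hD] phi Hphi.
pose s := h `^ alpha.
have s0 : 0 < s by rewrite powR_gt0.
have s1 : s <= 1.
  have -> : 1 = 1 `^ alpha by rewrite powR1.
  by rewrite ge0_ler_powR ?nnegrE ?ler01 ?(ltW h0) ?(ltW alpha0).
have hb : h `^ beta <= D.
  rewrite -[leRHS]powRr1 ?(ltW D0)// -(mulVf (lt0r_neq0 beta0)) powRrM.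
  by rewrite ge0_ler_powR ?nnegrE ?powR_ge0 ?(ltW h0) ?(ltW beta0).
apply: le_trans (resolvent_le r_gt0 h0 s0 Hphi 0) _.
rewrite enorm0 max_r ?(ltW s0)// -/s (_ : 2 * s = s + s) ?lerD2l; last by ring.
have si1 : 1 <= s^-1 by rewrite invf_ge1.
have si0 : 0 < s^-1 by rewrite invr_gt0.
have Ks : (4 * ((1 + 2 * r / s) * N.+1%:R)) ^+ N <= K ^+ N / s ^+ N.
  rewrite -expr_div_n; apply: lerXn2r; rewrite ?nnegrE.
  - rewrite !mulr_ge0// addr_ge0// mulr_ge0 ?(ltW r2)// ltW//.
  - by rewrite divr_ge0// ltW.
  - have -> : K / s = 4 * ((1 + 2 * r) / s * N.+1%:R) by rewrite /K; ring.
    by rewrite ler_pM2l// ler_pM2r// [leRHS]mulrDl mul1r lerD2r.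
apply: (@le_trans _ _ (h / (2 * r) * (K ^+ N / s ^+ N))).
  by rewrite ler_pM2l// divr_gt0.
have hE : h = h `^ beta * s ^+ N.+1.
  rewrite -powR_mulrn ?powR_ge0// -powRrM -powRD; last by rewrite (gt_eqF h0) implybT.
  by rewrite /beta subrK powRr1// ltW.
have -> : h / (2 * r) * (K ^+ N / s ^+ N) = h `^ beta / D * s.
  rewrite {1}hE exprSr /D; field.
  by rewrite !expf_neq0 ?gt_eqF.
by rewrite ger_pMl// ler_pdivrMr// mul1r.
Qed.
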